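(* For every integer $N\ge 2$ there exist unique (up to change of sign of each vector) vectors $\{\mathbf{T}_n\}_{0\le n<N}$ in $\mathbb{R}^N$ that satisfy the following three conditions: (i) the $\mathbf{T}_n$ are eigenvectors of the discrete Fourier transform: $\mathscr{F}\mathbf{T}_n=\lambda_n\mathbf{T}_n$ for $0\le n<N$ (for some scalars $\lambda_n$), where $\lambda_n=(-\mathrm{i})^n$ for $0\le n<N-1$; (ii) $\{\mathbf{T}_n\}_{0\le n<N}$ form an orthonormal basis of $\mathbb{R}^N$; (iii) $\operatorname{width}(\mathbf{T}_n)\le\lfloor (N+n+2)/4\rfloor$ for $0\le n<N$.
   Context: Let $I_N=\{k\in\mathbb{Z}: -\lceil N/2\rceil+1\le k\le\lfloor N/2\rfloor\}$. Entries of a vector $\mathbf{a}\in\mathbb{C}^N$ (or $\mathbb{R}^N$) are labelled by $I_N$, and $\mathbf{a}$ is identified with the $N$-periodic function on $\mathbb{Z}$ that agrees with it on $I_N$. The dot product is $\langle\mathbf{a},\mathbf{b}\rangle=\sum_{k\in I_N}\mathbf{a}(k)\mathbf{b}(k)$. The (centered) discrete Fourier transform is the linear map $\mathscr{F}$ on $\mathbb{C}^N$ given by $(\mathscr{F}\mathbf{a})(l)=\frac{1}{\sqrt{N}}\sum_{k\in I_N}e^{-\mathrm{i}\omega kl}\mathbf{a}(k)$, $l\in I_N$, with $\omega=2\pi/N$. For a nonzero vector $\mathbf{a}$, $\operatorname{width}(\mathbf{a})$ is the integer $n\in\{0,1,\dots,\lfloor N/2\rfloor\}$ such that $\mathbf{a}(n)\ne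 0$ or $\mathbf{a}(-n)\neq 0$, but $\mathbf{a}(k)=0$ whenever $n<|k|\le\lfloor N/2\rfloor$ (with $\mathbf{a}$ viewed as an $N$-periodic function). *)

(* Defs.v *)
From mathcomp Require Import all_boot all_order all_algebra.
From mathcomp Require Import complex.
From mathcomp Require Import boolp classical_sets reals trigo.
From mathcomp Require Import zify.

Set Implicit Arguments.
Unset Strict Implicit.
Unset Printing Implicit Defensive.

Import Order.TTheory GRing.Theory Num.Theory.
Local Open Scope ring_scope.
Local Open Scope complex_scope.

(* A vector in R^N or C^N is a row vector whose entries, in storage order
   0, ..., N-1, are labelled -ceil(N/2)+1, ..., floor(N/2): the entry stored at
   position i has label [label i]. *)
Definition label (N : nat) (i : 'I_N) : int := - (uphalf N)%:Z + 1 + i%:Z.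

Lemma label_inj (N : nat) : injective (@label N).
Proof. by move=> i j; rewrite /label => h; apply: val_inj => /=; lia. Qed.

Lemma label_range (N : nat) (k : int) :
  - (uphalf N)%:Z + 1 <= k <= (N./2)%:Z <-> exists i : 'I_N, label i = k.
Proof.
have Nh : (uphalf N + N./2 = N)%N by lia.
split=> [/andP[lek kle]|[i <-]].
  have kN : (absz (k + (uphalf N)%:Z - 1)%R < N)%N by lia.
  by exists (Ordinal kN); rewrite /label /=; lia.
by have := ltn_ord i; rewrite /label; lia.
Qed.

(* The N-periodic function on the integers that agrees with [a] on its labels.
   For N > 0 exactly one label is congruent to [k], so the default value is
   never used. *)
Definition periodic (K : nmodType) (N : nat) (a : 'rV[K]_N) (k : int) : K :=
  if [pick i : 'I_N | (label i == k %[mod N])%Z] is Some i then a 0 i else 0.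

Lemma periodic_label (K : nmodType) (N : nat) (a : 'rV[K]_N) (i : 'I_N) :
  periodic a (label i) = a 0 i.
Proof.
rewrite /periodic; case: pickP => [j|/(_ i)]; last by rewrite eqxx.
rewrite eqz_mod_dvd => /dvdzP[q jiq].
suff -> : j = i by [].
apply: val_inj => /=; move: jiq; rewrite /label => jiq.
have iN := ltn_ord i; have jN := ltn_ord j.
case: (ltrgtP q 0) => [qlt0|qgt0|q0]; [nia|nia|].
by move: jiq; rewrite q0 mul0r; lia.
Qed.

Lemma periodic_addN (K : nmodType) (N : nat) (a : 'rV[K]_N) (k : int) :
  periodic a (k + N%:Z) = periodic a k.
Proof. by rewrite /periodic modzDr. Qed.

Definition dotv (K : pzSemiRingType) (N : nat) (a b : 'rV[K]_N) : K :=
  \sum_(k < N) a 0 k * b 0 k.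

Definition has_width (K : nmodType) (N : nat) (a : 'rV[K]_N) (n : nat) : Prop :=
  [/\ (n <= N./2)%N,
      periodic a n%:Z != 0 \/ periodic a (- n%:Z) != 0
    & forall k : int, (n < `|k|)%N -> (`|k| <= N./2)%N -> periodic a k = 0].

(* Meaningful for nonzero vectors only; the zero vector gets the value 0. *)
Definition width (K : nmodType) (N : nat) (a : 'rV[K]_N) : nat :=
  xget 0%N [set n | has_width a n]%classic.

Lemma has_width_unique (K : nmodType) (N : nat) (a : 'rV[K]_N) (m n : nat) :
  has_width a m -> has_width a n -> m = n.
Proof.
suff le p q : has_width a p -> has_width a q -> (p <= q)%N.
  by move=> hm hn; apply/eqP; rewrite eqn_leq !le.
move=> [pN pn0 _] [_ _ q0]; rewrite leqNgt; apply/negP => qp.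
by case: pn0; rewrite q0 ?eqxx ?abszN ?absz_nat.
Qed.

Lemma widthP (K : nmodType) (N : nat) (a : 'rV[K]_N) :
  a != 0 -> has_width a (width a).
Proof.
move=> /rV0Pn[i ai0]; apply: xgetPex.
pose P n := (n <= N./2)%N && ((periodic a n%:Z != 0) || (periodic a (- n%:Z) != 0)).
have exP : exists n, P n.
  exists `|label i|%N; apply/andP; split.
    by have /label_range := ex_intro (fun j => label j = label i) i erefl; lia.
  have : periodic a (label i) != 0 by rewrite periodic_label.
  case: (label i) => [n|n] /= -> //.
  by rewrite orbT.
have ubP n : P n -> (n <= N./2)%N by case/andP.
case: (ex_maxnP exP ubP) => m /andP[mN /orP pm] mmax; exists m; split=> //.
move=> k mk kN; apply: contraTeq mk => k0; rewrite -leqNgt mmax //.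
rewrite /P kN /=; case: k k0 {kN} => n /= n0; first by rewrite n0.
by rewrite -NegzE n0 orbT.
Qed.

Definition expi (R : realType) (x : R) : R[i] := cos x +i* sin x.

Definition dft (R : realType) (N : nat) (a : 'rV[R[i]]_N) : 'rV[R[i]]_N :=
  let omega := 2 * pi / N%:R in
  \row_(l < N) (((Num.sqrt N%:R)^-1)%:C *
    \sum_(k < N) expi (- (omega * (label k)%:~R * (label l)%:~R)) * a 0 k).

Definition complexify (R : realType) (N : nat) (a : 'rV[R]_N) : 'rV[R[i]]_N :=
  map_mx (real_complex R) a.

Definition eigenvector (K : fieldType) (V : lmodType K) (f : V -> V) (c : K)
    (v : V) : Prop :=
  v != 0 /\ f v = c *: v.

Definition orthonormal_basis (R : realType) (N : nat) (T : 'I_N -> 'rV[R]_N) :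
    Prop :=
  (forall m n, dotv (T m) (T n) = (m == n)%:R) /\ basis_of fullv (codom T).

Definition minimal_hermite_basis (R : realType) (N : nat) (T : 'I_N -> 'rV[R]_N) :
    Prop :=
  [/\ exists lambda : 'I_N -> R[i],
        (forall n, eigenvector (@dft R N) (lambda n) (complexify (T n))) /\
        (forall n : 'I_N, (n < N.-1)%N -> lambda n = (- 'i%C) ^+ n),
      orthonormal_basis T
    & forall n : 'I_N, (width (T n) <= (N + n + 2) %/ 4)%N].

(* Main.v *)
Require Import Defs.
From mathcomp Require Import all_boot all_order all_algebra.
From mathcomp Require Import complex.
From mathcomp Require Import boolp reals trigo.
From mathcomp Require Import zify ring lra.

Set Implicit Arguments.
Unset Strict Implicit.
Unset Printing Implicit Defensive.
Import Order.TTheory GRing.Theory Num.Theory.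
Local Open Scope ring_scope.

(** The transform of a real vector [a] is [a *m C - i (a *m S)], where the real
symmetric matrices [C] and [S] have the entries cos(omega k l) / sqrt N and
sin(omega k l) / sqrt N, and [C *m C + S *m S = 1].  Even vectors are killed by
[S] and odd ones by [C], so the eigenvectors for (-i)^n are the even (n even) or
odd (n odd) real vectors that [C], respectively [S], multiplies by a sign [eps],
which depends on n modulo 4.  For a given parity write [y] for the values of the
vector at the [d] labels that determine it.  On [y] the transform is a [d] by
[d] matrix [G] with [G *m G = 1] and, since cos(j t) and sin((j + 1) t) / sin t
are polynomials of degree j in cos t with positive leading coefficients, the
k-th value of [y *m G] is [s k * p.[x k]].  Here [s k] is positive, the nodes
[x k = cos(omega k)] decrease, and the degree of [p] is the index of the last
nonzero coordinate of [y].

This gives an uncertainty principle.  If [y *m G = eps *: y] and only the first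
[h] coordinates of [y] may be nonzero, then [p] has degree less than [h] and
vanishes at [d - h] distinct nodes, so [y = 0] when [2 h <= d].  When
[2 h = d + 1] the roots determine [p] up to a scalar, and the value of [p] at
the node next above its largest root has the sign of its leading coefficient, which
is the sign of the last nonzero coordinate of [y]; this excludes [eps = -1]
([short_eigenvector_eq0]).  Hence the eigenspaces have dimensions at most
[uphalf d] and [d./2].  As [G *m G = 1] these dimensions add up to [d], so both
bounds are equalities ([rank_eigenspace]).  Counting linear conditions, the
eigenvectors supported on the first [r] coordinates form a space of dimension
exactly [r - d./2] or [r - uphalf d].

For [n < N - 1] the width bound of the theorem makes this dimension
[n %/ 4 + 1] ([hermite_dims]).  The spaces for n, n - 4, n - 8, and so on
are nested, and those for indices that differ modulo 4 are orthogonal.  So each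
[T n] must be a unit vector of its space orthogonal to [n %/ 4] earlier vectors:
it exists, and it is unique up to sign.  The last vector is the unit normal to
all the others; it is an eigenvector because [C] and [S] are symmetric. *)

(** * Counting linear conditions *)

(** All dimension counts below, lower and upper, have this form: [c] linear
conditions cannot kill a space of dimension greater than [c]. *)
Lemma ex_sub_ker (F : fieldType) (p n c : nat) (B : 'M[F]_(p, n))
    (Q : 'M[F]_(n, c)) : (c < \rank B)%N ->
  exists v : 'rV_n, [/\ v != 0, (v <= B)%MS & v *m Q = 0].
Proof.
move=> cB; pose K := (B :&: kermx Q)%MS.
have K0 : K != 0.
  rewrite -mxrank_eq0 -lt0n; have := mxrank_mul_ker B Q.
  by have := rank_leq_col (B *m Q); rewrite -/K; lia.
exists (nz_row K); split; first by rewrite nz_row_eq0.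
  by apply: submx_trans (nz_row_sub _) (capmxSl _ _).
by apply/sub_kermxP; apply: submx_trans (nz_row_sub _) (capmxSr _ _).
Qed.

Definition coord_mx (F : fieldType) (d h r : nat) : 'M[F]_(d, r - h) :=
  \matrix_(i, j) (i == h + j :> nat)%N%:R.

Lemma mul_coord_mx (F : fieldType) (d h r : nat) (y : 'rV[F]_d) :
  (r <= d)%N ->
  y *m coord_mx F d h r = 0 <->
  (forall k : 'I_d, (h <= k < r)%N -> y 0 k = 0).
Proof.
move=> rd; split=> [/rowP y0 k /andP[hk kr]|y0].
  have kh : (k - h < r - h)%N by lia.
  have := y0 (Ordinal kh); rewrite !mxE (bigD1 k) //= mxE /= subnKC // eqxx.
  rewrite mulr1 big1 ?addr0 // => i ik; rewrite mxE /= subnKC //.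
  by rewrite -val_eqE /= in ik; rewrite (negPf ik) mulr0.
apply/rowP => j; rewrite !mxE big1 // => i _; rewrite mxE.
case: eqP => [ij|_]; last by rewrite mulr0.
by rewrite y0 ?mul0r //; have := ltn_ord j; lia.
Qed.

(** * Involutions given by polynomial values *)

Section PolynomialKernel.
Variables (R : realFieldType) (d : nat) (G : 'M[R]_d).
Variables (P : 'I_d -> {poly R}) (x s : 'I_d -> R).
Hypothesis sizeP : forall i, size (P i) = i.+1.
Hypothesis leadP : forall i, 0 < lead_coef (P i).
Hypothesis x_decr : forall i j : 'I_d, (i < j)%N -> x j < x i.
Hypothesis s_gt0 : forall i, 0 < s i.
Hypothesis GE : forall i j, G i j = s j * (P i).[x j].

(** An eigenvector for the sign (-1)^e that lives on this many leading
coordinates vanishes; the negative sign tolerates the larger half of [d]. *)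
Definition threshold (e : bool) : nat := if e then uphalf d else d./2.

(** The discrete uncertainty principle: the coordinates of [y] past its last
nonzero one, [k], give [d - k.+1] roots of a polynomial of degree [k]. *)
Lemma short_eigenvector_eq0 (e : bool) (y : 'rV[R]_d) :
  y *m G = (-1) ^+ e *: y ->
  (forall k : 'I_d, (threshold e <= k)%N -> y 0 k = 0) -> y = 0.
Proof.
move=> yG yh; apply/eqP; apply: contraT => /rV0Pn[k0 yk0].
case: (@arg_maxnP _ k0 (fun k => y 0 k != 0) (fun k => k : nat) yk0) => k yk kmax.
have y_gt (j : 'I_d) : (k < j)%N -> y 0 j = 0.
  by move=> kj; apply: contraTeq kj => /kmax; rewrite -leqNgt.
have kh : (k < threshold e)%N.
  by rewrite ltnNge; apply: contra yk => /yh ->.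
pose p := \sum_i y 0 i *: P i.
pose q := \sum_(i | i != k) y 0 i *: P i.
have pE : p = y 0 k *: P k + q by rewrite /p (bigD1 k).
have sq : (size q <= k)%N.
  apply: leq_trans (size_sum _ _ _) _; apply/bigmax_leqP => i ik.
  case: (ltngtP i k) => [lik|lki|/val_inj/eqP]; last by rewrite (negPf ik).
    by apply: leq_trans (size_scale_leq _ _) _; rewrite sizeP.
  by rewrite y_gt // scale0r size_poly0.
have sk : size (y 0 k *: P k) = k.+1 by rewrite size_scale ?sizeP.
have sp : size p = k.+1 by rewrite pE size_polyDl sk.
have lp : lead_coef p = y 0 k * lead_coef (P k).
  by rewrite pE lead_coefDl ?lead_coefZ // sk.
have yGE j : (-1) ^+ e * y 0 j = s j * p.[x j].
  have /rowP/(_ j) := yG; rewrite !mxE => <-.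
  rewrite /p horner_sum mulr_sumr; apply: eq_bigr => i _.
  by rewrite GE hornerZ mulrCA.
pose rs := [seq x j | j : 'I_d <- enum [pred j : 'I_d | (k < j)%N]].
have x_inj : injective x.
  move=> i j xij; apply: val_inj; case: (ltngtP i j) => // /x_decr;
  by rewrite xij ltxx.
have urs : uniq rs by rewrite map_inj_uniq ?enum_uniq.
have rrs : all (root p) rs.
  apply/allP => z /mapP[j]; rewrite mem_enum inE => /y_gt yj ->.
  have := yGE j; rewrite yj mulr0 => /esym/eqP.
  by rewrite mulf_eq0 gt_eqF //.
have srs : size rs = (d - k.+1)%N.
  rewrite size_map -cardE.
  rewrite -[RHS](card_ord (d - k.+1)).
  have kd := ltn_ord k.
  have f_proof (j : 'I_(d - k.+1)) : (k.+1 + j < d)%N.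
    by have := ltn_ord j; lia.
  pose f j := Ordinal (f_proof j).
  have f_inj : injective f by move=> i j [] /addnI/val_inj.
  rewrite -(card_image f_inj); apply: eq_card => j; rewrite inE.
  apply/idP/imageP => [kj|[i _ ->]]; last by rewrite /= leq_addr.
  have jk : (j - k.+1 < d - k.+1)%N by have := ltn_ord j; lia.
  by exists (Ordinal jk) => //; apply: val_inj => /=; lia.
have p0 : p != 0 by rewrite -size_poly_eq0 sp.
have := max_poly_roots p0 rrs; rewrite srs sp => /(_ urs) dk.
(* Counting roots leaves only the case where all roots of [p] are known. *)
have [eT dE] : e /\ d = k.*2.+1.
  have kd := ltn_ord k; move: kh dk.
  by rewrite /threshold; case: e {yG yh yGE} => /=; lia.
have pP : p = lead_coef p *: \prod_(z <- rs) ('X - z%:P).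
  by apply: all_roots_prod_XsubC; rewrite ?uniq_rootsE // sp srs; lia.
have prod_gt0 : 0 < \prod_(z <- rs) (x k - z).
  rewrite big_seq; apply: prodr_gt0 => z /mapP[j]; rewrite mem_enum inE => kj ->.
  by rewrite subr_gt0 x_decr.
(* The node [x k] lies to the right of all roots of [p], so [p] has there the
   sign of its leading coefficient, which is that of [y 0 k]. *)
have := yGE k; rewrite eT expr1 mulN1r pP lp hornerZ horner_prod.
under eq_bigr do rewrite hornerXsubC.
move: prod_gt0 (s_gt0 k) (leadP k) yk.
move: (\prod_(_ <- _) _) (s k) (lead_coef _) (y 0 k) => u v w z u0 v0 w0 z0 H.
have : (1 + v * w * u) * z = 0 by lra.
have := mulr_gt0 (mulr_gt0 v0 w0) u0.
move=> vwu /eqP; rewrite mulf_eq0 (negPf z0) orbF gt_eqF //; lra.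
Qed.

Hypothesis GG : G *m G = 1%:M.

(** Each eigenspace is at most this large, because the coordinates from the
threshold on determine its vectors; the two bounds add up to [d], which is the
sum of the dimensions for an involution. *)
Lemma rank_eigenspace (e : bool) :
  \rank (eigenspace G ((-1) ^+ e)) = (d - threshold e)%N.
Proof.
have le (f : bool) : (\rank (eigenspace G ((-1) ^+ f)) <= d - threshold f)%N.
  rewrite leqNgt; apply/negP => /(ex_sub_ker (coord_mx R d (threshold f) d)).
  case=> v [/eqP v0 /eigenspaceP vG /mul_coord_mx vh]; apply: v0.
  by apply: short_eigenvector_eq0 vG _ => k hk; apply: vh; rewrite ?hk ?ltn_ord.
have sum : (d <= \rank (eigenspace G ((-1) ^+ e))
                + \rank (eigenspace G ((-1) ^+ ~~ e)))%N.
  have: (1%:M <= eigenspace G ((-1) ^+ e) + eigenspace G ((-1) ^+ ~~ e))%MS.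
    have -> : 1%:M = 2^-1 *: (1%:M + (-1) ^+ e *: G)
                     + 2^-1 *: (1%:M - (-1) ^+ e *: G).
      rewrite -scalerDr addrACA subrr addr0 -mulr2n -scaler_nat scalerA.
      by rewrite mulVf ?scale1r // pnatr_eq0.
    apply: addmx_sub_adds; apply: scalemx_sub; apply/eigenspaceP.
      rewrite mulmxDl mul1mx -scalemxAl GG scalerDr scalerA addrC.
      by rewrite -expr2 sqrr_sign scale1r.
    rewrite mulmxBl mul1mx -scalemxAl GG scalerBr scalerA signrN.
    by rewrite mulNr -expr2 sqrr_sign scaleN1r opprK scaleNr addrC.
  move/mxrankS; rewrite mxrank1 => /leq_trans; apply.
  by case: (mxrank_adds_leqif (eigenspace G ((-1) ^+ e))
                              (eigenspace G ((-1) ^+ ~~ e))).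
have := le e; have := le (~~ e); move: sum; rewrite /threshold.
by case: e => /=; lia.
Qed.

Lemma ex_eigenvector (e : bool) (r c : nat) (Q : 'M[R]_(d, c)) :
  (r <= d)%N -> (c + threshold e < r)%N ->
  exists y : 'rV_d, [/\ y != 0, y *m G = (-1) ^+ e *: y,
    forall k : 'I_d, (r <= k)%N -> y 0 k = 0 & y *m Q = 0].
Proof.
move=> rd cr.
have : (d - r + c < \rank (eigenspace G ((-1) ^+ e)))%N.
  by rewrite rank_eigenspace; lia.
case/(ex_sub_ker (row_mx (coord_mx R d r d) Q)) => y [y0 /eigenspaceP yG].
rewrite mul_mx_row => /eqP; rewrite row_mx_eq0 => /andP[/eqP yr /eqP yQ].
exists y; split=> // k rk; move/mul_coord_mx: yr; apply=> //.
by rewrite rk ltn_ord.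
Qed.

Lemma row_free_eigenvectors (e : bool) (r p : nat) (A : 'M[R]_(p, d)) :
  (r <= d)%N -> row_free A -> A *m G = (-1) ^+ e *: A ->
  (forall i (k : 'I_d), (r <= k)%N -> A i k = 0) ->
  (p <= r - threshold e)%N.
Proof.
move=> rd /eqP rA AG Ar; rewrite leqNgt -rA; apply/negP.
case/(ex_sub_ker (coord_mx R d (threshold e) r)) => v [/eqP v0 /submxP[u vE]].
move=> /mul_coord_mx vh; apply: v0; apply: (@short_eigenvector_eq0 e).
  by rewrite vE -mulmxA AG -scalemxAr.
move=> k hk; case: (ltnP k r) => kr; first by apply: vh; rewrite ?hk.
by rewrite vE mxE big1 // => i _; rewrite Ar ?mulr0.
Qed.
End PolynomialKernel.

(** * Labels of half of the indices *)

Section Index.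
Variable N : nat.

Lemma label_bound (l : 'I_N) : (`|label l| <= N./2)%N.
Proof. by have := ltn_ord l; rewrite /label; lia. Qed.

(** The index whose label is the opposite one modulo N: with 2L + 1 or 2L
entries, the index k is sent to 2L - k or 2L - 2 - k, except that for N = 2L
the label L is its own opposite. *)
Definition neg_ord (k : 'I_N) : 'I_N :=
  if insub (((uphalf N).-1).*2 - k)%N is Some k' then
    if (k <= ((uphalf N).-1).*2)%N then k' else k
  else k.

Lemma label_neg_ord k : (`|label k|%N.*2 < N)%N -> label (neg_ord k) = - label k.
Proof.
rewrite /neg_ord /label => kN; have kltN := ltn_ord k.
by case: insubP => [k' _ /= k'E|]; last (by lia); case: ifP => /=; lia.
Qed.

Lemma neg_ord_fixed k : (N <= `|label k|%N.*2)%N -> neg_ord k = k.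
Proof.
rewrite /neg_ord /label => kN; have kltN := ltn_ord k.
by case: insubP => [k' _ /= k'E|//]; case: ifP => //=; lia.
Qed.

Lemma neg_ordK : involutive neg_ord.
Proof.
move=> k; have [kN|kN] := ltnP (`|label k|%N.*2) N; last by rewrite !neg_ord_fixed.
apply: (@label_inj N); rewrite label_neg_ord ?label_neg_ord ?opprK //.
by rewrite abszN.
Qed.

(** The dimension of the space of even (b = false) or odd (b = true) vectors.
An odd vector vanishes at the label 0 and, for N even, at N/2. *)
Definition halfdim (b : bool) : nat := if b then (uphalf N).-1 else N./2.+1.

Hypothesis N_gt0 : (0 < N)%N.

Lemma pos_proof b (i : 'I_(halfdim b)) : ((uphalf N).-1 + i + b < N)%N.
Proof. by case: b i => i; have := ltn_ord i; rewrite /halfdim /=; lia. Qed.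

(** The coordinate [i] of a vector of parity [b] is its value at the label
[i + b], the label 0 being skipped for odd vectors. *)
Definition pos b (i : 'I_(halfdim b)) : 'I_N := Ordinal (pos_proof i).

Lemma label_pos b (i : 'I_(halfdim b)) : label (pos i) = (i + b)%N%:Z.
Proof. by rewrite /label /=; lia. Qed.

End Index.

(** * Cosines and sines as polynomials in the cosine *)

Section Trig.
Variable R : realType.
Implicit Types (b : bool) (t : R).

Lemma sin_pi_mulz (m : int) : sin (pi * m%:~R) = 0 :> R.
Proof.
have nat_case (n : nat) : sin (pi * n%:R) = 0 :> R.
  elim: n => [|n IHn]; first by rewrite mulr0 sin0.
  by rewrite -natr1 mulrDr mulr1 sinDpi IHn oppr0.
case: m => n; first exact: nat_case.
by rewrite NegzE mulrNz mulrN sinN nat_case oppr0.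
Qed.

Definition trig b t : R := if b then sin t else cos t.

Lemma trigN b t : trig b (- t) = (-1) ^+ b * trig b t.
Proof. by case: b; rewrite /= ?sinN ?cosN ?expr1 ?mulN1r ?mul1r. Qed.

Definition parity_sign b (k : int) : R := (-1) ^+ (b && (k < 0)).

Lemma parity_sign2 b k : parity_sign b k * parity_sign b k = 1.
Proof. by rewrite -expr2 sqrr_sign. Qed.

Lemma trig_parity b (k : int) t :
  trig b (t * k%:~R) = parity_sign b k * trig b (t * `|k|%:R).
Proof.
rewrite /parity_sign; case: k => n /=; first by rewrite andbF mul1r.
by rewrite andbT NegzE mulrNz mulrN trigN.
Qed.

(** The Chebyshev polynomials of the first (b = false) and second (b = true)
kind: the same recurrence, started from 1 and X or from 1 and 2X. *)
Fixpoint chebyshev b (n : nat) : {poly R} :=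
  match n with
  | 0 => 1
  | n'.+1 => match n' with
            | 0 => (1 + b)%:R *: 'X
            | n''.+1 => 2 *: ('X * chebyshev b n') - chebyshev b n''
            end
  end.

Lemma horner_chebyshev b n t :
  trig b (t * (n + b)%:R) = (if b then sin t else 1) * (chebyshev b n).[cos t].
Proof.
suff [] : trig b (t * (n + b)%:R)
     = (if b then sin t else 1) * (chebyshev b n).[cos t]
  /\ trig b (t * (n.+1 + b)%:R)
     = (if b then sin t else 1) * (chebyshev b n.+1).[cos t] by [].
elim: n => [|n [IHn IHSn]].
  rewrite /= hornerC hornerZ hornerX.
  case: b; rewrite /= ?mulr1 ?mulr0 ?mul1r ?cos0 ?addn0 ?mul1r ?mulr1 //.
  by rewrite mulr_natr sin_mulr2n; split=> //; rewrite -mulr_natr; ring.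
split=> //; rewrite [chebyshev b n.+2]/= -/(chebyshev b n.+1).
rewrite hornerD hornerN hornerZ hornerM hornerX mulrBr -IHn.
have -> : forall u v w : R, u * (2 * (v * w)) = 2 * v * (u * w) by move=> *; ring.
rewrite -IHSn; set u := t * (n.+1 + b)%:R.
have -> : t * (n.+2 + b)%:R = u + t by rewrite /u !addSn -[in LHS]natr1; ring.
have -> : t * (n + b)%:R = u - t by rewrite /u !addSn -natr1; ring.
by case: (b); rewrite /= ?sinB ?cosB ?sinD ?cosD; ring.
Qed.

Lemma size_lead_chebyshev b n :
  size (chebyshev b n) = n.+1 /\ 0 < lead_coef (chebyshev b n).
Proof.
suff [] : (size (chebyshev b n) = n.+1 /\ 0 < lead_coef (chebyshev b n)) /\
  (size (chebyshev b n.+1) = n.+2 /\ 0 < lead_coef (chebyshev b n.+1)) by [].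
elim: n => [|n [[sn ln] [sSn lSn]]].
  rewrite /= size_poly1 lead_coef1 ltr01 size_scale ?pnatr_eq0 // size_polyX.
  by rewrite lead_coefZ lead_coefX mulr1 ltr0n.
split=> //; rewrite [chebyshev b n.+2]/= -/(chebyshev b n.+1).
have s2 : size (2 *: ('X * chebyshev b n.+1)) = n.+3.
  by rewrite size_scale ?pnatr_eq0 // mulrC size_mulX ?sSn // -size_poly_eq0 sSn.
rewrite size_polyDl ?s2 ?size_polyN ?sn //; split=> //.
rewrite lead_coefDl ?s2 ?size_polyN ?sn // lead_coefZ lead_coefM lead_coefX.
by rewrite mul1r mulr_gt0.
Qed.

End Trig.

(** * Width and dot product *)

Lemma width_leP (K : nmodType) (N : nat) (a : 'rV[K]_N) (w : nat) : a != 0 ->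
  (width a <= w)%N <-> (forall k : 'I_N, (w < `|label k|)%N -> a 0 k = 0).
Proof.
move=> /widthP [wN wn0 w0]; split=> [ww k wk|a0].
  rewrite -periodic_label w0 //; first exact: leq_ltn_trans ww wk.
  exact: label_bound.
rewrite leqNgt; apply/negP => ww.
(* For N = 2L the label -L is absent, and L is the representative of -L. *)
have per0 (z : int) : `|z|%N = width a -> Defs.periodic a z = 0.
  move=> zw; rewrite /Defs.periodic; case: pickP => // i /eqP iz.
  apply: a0; move: iz => /eqP; rewrite eqz_mod_dvd => /dvdzP[q iz].
  have lN := label_bound i; have iN := ltn_ord i.
  have : q = 0 \/ q = 1 \/ q = -1 by nia.
  by case=> [q0|[q0|q0]]; move: iz; rewrite q0; lia.
by case: wn0; rewrite per0 ?eqxx // abszN.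
Qed.

Section Dot.
Variables (R : realType) (N : nat).
Implicit Types (a b : 'rV[R]_N).

Lemma dotvE a b : dotv a b = (a *m b^T) 0 0.
Proof. by rewrite mxE; apply: eq_bigr => k _; rewrite mxE. Qed.

Lemma dotvC a b : dotv a b = dotv b a.
Proof. by apply: eq_bigr => k _; rewrite mulrC. Qed.

Lemma dotvZl c a b : dotv (c *: a) b = c * dotv a b.
Proof. by rewrite !dotvE -scalemxAl mxE. Qed.

Lemma dotvBl a a' b : dotv (a - a') b = dotv a b - dotv a' b.
Proof. by rewrite !dotvE mulmxBl !mxE. Qed.

Lemma dotv0l b : dotv 0 b = 0 :> R.
Proof. by rewrite dotvE mul0mx mxE. Qed.

Lemma dotv_sym (X : 'M[R]_N) a b : X^T = X -> dotv (a *m X) b = dotv a (b *m X).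
Proof. by move=> XT; rewrite !dotvE trmx_mul XT mulmxA. Qed.

Lemma dotv_gt0 a : a != 0 -> 0 < dotv a a.
Proof.
case/rV0Pn => k ak; rewrite /dotv (bigD1 k) //= ltr_pwDl //.
  by rewrite -expr2 exprn_even_gt0.
by apply: sumr_ge0 => i _; rewrite -expr2 sqr_ge0.
Qed.

Lemma ex_unit a : a != 0 -> exists c, dotv (c *: a) (c *: a) = 1.
Proof.
move=> a0; have aa := dotv_gt0 a0.
exists (Num.sqrt (dotv a a))^-1.
rewrite dotvZl dotvC dotvZl mulrA -invfM -expr2 sqr_sqrtr ?(ltW aa) //.
by rewrite mulVf ?gt_eqF.
Qed.

Lemma orthonormal_expand (T : 'I_N -> 'rV[R]_N) v :
  (forall m n, dotv (T m) (T n) = (m == n)%:R) ->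
  v = \sum_m dotv v (T m) *: T m.
Proof.
move=> TT; pose M := \matrix_m T m.
have MM : M *m M^T = 1%:M.
  apply/matrixP => i j; rewrite [RHS]mxE -TT mxE.
  by apply: eq_bigr => k _; rewrite !mxE.
rewrite -[LHS]mulmx1 -(mulmx1C MM) mulmxA.
apply/rowP => j; rewrite mxE summxE; apply: eq_bigr => m _.
rewrite !mxE; congr (_ * _).
by apply: eq_bigr => k _; rewrite !mxE.
Qed.

Lemma orthonormal_basis_of (T : 'I_N -> 'rV[R]_N) :
  (forall m n, dotv (T m) (T n) = (m == n)%:R) -> orthonormal_basis T.
Proof.
move=> TT; split=> //; rewrite basisEdim size_map -cardE card_ord.
rewrite dimvf /dim /= mul1n leqnn andbT.
apply/subvP => v _; rewrite (orthonormal_expand v TT).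
by apply: rpred_sum => m _; apply: rpredZ; apply: memv_span; apply: codom_f.
Qed.
End Dot.

(** * The cosine and sine parts of the transform *)

Section DFT.
Variables (R : realType) (N : nat).
Hypothesis N_gt0 : (0 < N)%N.
Let omega : R := 2 * pi / N%:R.

Let N_neq0 : N%:R != 0 :> R. Proof. by rewrite pnatr_eq0 -lt0n. Qed.

(** After multiplication by 2 sin(omega m / 2) the sum over a full period
telescopes. *)
Lemma sum_cos_eq0 (m : int) : m != 0 -> (`|m| < N)%N ->
  \sum_(k < N) cos (omega * (label k)%:~R * m%:~R) = 0 :> R.
Proof.
move=> m0 mN.
pose th : R := pi * m%:~R / N%:R.
have sin_th : sin th != 0.
  have pos (n : nat) : (0 < n < N)%N -> sin (pi * n%:R / N%:R) != 0 :> R.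
    case/andP=> n0 nN; rewrite gt_eqF // sin_gt0_pi //.
    rewrite divr_gt0 ?mulr_gt0 ?pi_gt0 ?ltr0n //=.
    by rewrite ltr_pdivrMr ?ltr0n // ltr_pM2l ?pi_gt0 // ltr_nat.
  rewrite /th; case: m m0 mN @th => n n0 nN; first by apply: pos; lia.
  by rewrite NegzE mulrNz mulrN mulNr sinN oppr_eq0 pos //; lia.
(* So [th * (c + 2 * j)] is omega m (label j - 1/2). *)
pose c : R := (1 - (uphalf N)%:R) * 2 - 1.
pose f (j : nat) : R := sin (th * (c + 2 * j%:R)).
apply: (mulfI (mulf_neq0 (_ : 2 != 0) sin_th)); first by rewrite pnatr_eq0.
rewrite mulr0 mulr_sumr.
transitivity (\sum_(0 <= j < N) (f j.+1 - f j)).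
  rewrite big_mkord; apply: eq_bigr => j _.
  have -> : omega * (label j)%:~R * m%:~R = th * (c + 2 * j%:R) + th.
    by rewrite /omega /th /c /label !rmorphD /= rmorphN /= -!pmulrn; field.
  rewrite /f; have -> : th * (c + 2 * j.+1%:R) = th * (c + 2 * j%:R) + th + th.
    by rewrite -natr1; ring.
  have one x : x = x * (cos th ^+ 2 + sin th ^+ 2) by rewrite cos2Dsin2 mulr1.
  rewrite [X in _ = _ - X]one !sinD cosD.
  by set u := sin th; set v := cos th; ring.
rewrite telescope_sumr // /f.
have -> : th * (c + 2 * N%:R) = th * (c + N%:R) + pi * m%:~R.
  by rewrite /th; field.
have -> : th * (c + 2 * 0%:R) = th * (c + N%:R) - pi * m%:~R.
  by rewrite /th; field.
by rewrite sinB sinD sin_pi_mulz; ring.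
Qed.

Definition dft_part (b : bool) : 'M[R]_N :=
  \matrix_(k, l) (trig b (omega * (label k)%:~R * (label l)%:~R)
                  / Num.sqrt N%:R).

Lemma dft_part_tr b : (dft_part b)^T = dft_part b.
Proof. by apply/matrixP => k l; rewrite !mxE; congr (trig b _ / _); ring. Qed.

(** The transform is unitary: this is the real part of [F *m conj F = 1]. *)
Lemma dft_part_isometry :
  dft_part false *m dft_part false + dft_part true *m dft_part true = 1%:M.
Proof.
apply/matrixP => k l; rewrite !mxE -big_split /=.
have sqrtN : Num.sqrt N%:R * Num.sqrt N%:R = N%:R :> R.
  by rewrite -expr2 sqr_sqrtr ?ler0n.
transitivity ((\sum_(j < N) cos (omega * (label j)%:~R * (label k - label l)%:~R))
              / N%:R :> R).
  rewrite mulr_suml; apply: eq_bigr => j _; rewrite !mxE.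
  rewrite rmorphB /= mulrBr cosB.
  rewrite [omega * (label k)%:~R * (label j)%:~R]mulrAC.
  by rewrite mulrACA [X in _ + X]mulrACA -mulrDl -invfM sqrtN.
have [->|kl] := eqVneq k l.
  under eq_bigr do rewrite subrr mulr0 cos0.
  by rewrite sumr_const card_ord divff.
rewrite sum_cos_eq0 ?mul0r // ?subr_eq0 ?(inj_eq (@label_inj N)) //.
by have := ltn_ord k; have := ltn_ord l; rewrite /label; lia.
Qed.

Definition parity_ext b : 'M[R]_(halfdim N b, N) :=
  \matrix_(i, k) if `|label k|%N == (i + b)%N then parity_sign R b (label k) else 0.

Lemma parity_ext_pos b : colsub (@pos N N_gt0 b) (parity_ext b) = 1%:M.
Proof.
apply/matrixP => i j; rewrite !mxE label_pos absz_nat eqn_add2r eq_sym.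
by rewrite /parity_sign /= andbF -val_eqE /=; case: eqP.
Qed.

Lemma parity_extE b p (A : 'M[R]_(p, halfdim N b)) i l (j : 'I_(halfdim N b)) :
  `|label l|%N = (j + b)%N ->
  (A *m parity_ext b) i l = A i j * parity_sign R b (label l).
Proof.
move=> lj; rewrite mxE (bigD1 j) //= mxE lj eqxx big1 ?addr0 // => k kj.
by rewrite mxE lj eqn_add2r eq_sym (inj_eq val_inj) (negPf kj) mulr0.
Qed.

(** Each row of the cosine (sine) matrix is an even (odd) function of the
label, so the columns at the labels of [pos] determine all others. *)
Lemma dft_part_parity b :
  dft_part b = colsub (@pos N N_gt0 b) (dft_part b) *m parity_ext b.
Proof.
apply/matrixP => k l; have lN := label_bound l.
have [/existsP[j /eqP lj]|/existsPn nj] :=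
    boolP [exists j : 'I_(halfdim N b), `|label l|%N == (j + b)%N].
  rewrite (parity_extE _ _ lj) !mxE label_pos trig_parity lj.
  by rewrite [RHS]mulrAC [X in X / _ = _]mulrC.
rewrite [RHS]mxE big1 => [|j _]; last first.
  by rewrite [X in _ * X]mxE (negPf (nj j)) mulr0.
case: b nj => nj; last first.
  have lh : (`|label l| < halfdim N false)%N by [].
  by have := nj (Ordinal lh); rewrite /= addn0 eqxx.
have [l0|l0] := eqVneq (label l) 0.
  by rewrite mxE l0 mulr0 /= sin0 mul0r.
have lh : (N <= `|label l|%N.*2)%N.
  rewrite leqNgt; apply/negP => lh.
  have lh' : (`|label l|.-1 < halfdim N true)%N by rewrite /halfdim /=; lia.
  by have /eqP := nj (Ordinal lh'); rewrite /=; lia.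
(* Only the label N/2 is left, where sin(omega k N/2) = sin(pi k) = 0. *)
have lE : label l = N./2 by rewrite /label in lh l0 lN *; have := ltn_ord l; lia.
have NE : N%:R = N./2%:R * 2 :> R by rewrite -natrM; congr _%:R; lia.
have h0 : N./2%:R != 0 :> R by move: N_neq0; rewrite NE mulf_eq0 => /norP[].
have arg : omega * (label k)%:~R * (N./2%:Z)%:~R = pi * (label k)%:~R.
  by rewrite /omega NE -pmulrn; field.
by rewrite mxE /= lE arg sin_pi_mulz mul0r.
Qed.

(** Even and odd vectors are orthogonal: reversing the labels changes the sign
of each product. *)
Lemma parity_ext_orth b : parity_ext b *m (parity_ext (~~ b))^T = 0.
Proof.
apply/matrixP => i j; rewrite !mxE.
set S := (LHS); suff : S = - S by move=> h; apply: (@mulfI _ 2); lra.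
rewrite {1}/S (reindex_inj (inv_inj (@neg_ordK N))) /S -sumrN.
apply: eq_bigr => k _; rewrite !mxE.
have [kN|kN] := ltnP (`|label k|%N.*2) N.
  rewrite label_neg_ord // abszN.
  case: eqP => [ki|_]; last by rewrite !mul0r oppr0.
  case: eqP => [kj|_]; last by rewrite !mulr0 oppr0.
  have k0 : label k != 0.
    by apply/eqP => k0; move: ki kj; rewrite k0; clear; lia.
  rewrite /parity_sign; case: (b) => /=;
  by case: (ltrgtP (label k) 0) k0 => //=; rewrite ?oppr_lt0 ?oppr_gt0 ?oppr0 //;
    move=> k0 _; rewrite ?(lt_gtF k0) ?k0; ring.
rewrite neg_ord_fixed //.
case: eqP => [ki|_]; last by rewrite !mul0r oppr0.
case: eqP => [kj|_]; last by rewrite !mulr0 oppr0.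
have := ltn_ord i; have := ltn_ord j; move: ki kj kN; rewrite /halfdim.
by clear S; case: b i j => i j /=; lia.
Qed.

Lemma parity_ext_dft_neq b : parity_ext b *m dft_part (~~ b) = 0.
Proof.
by rewrite -dft_part_tr dft_part_parity trmx_mul mulmxA parity_ext_orth mul0mx.
Qed.

(** The matrix of the transform, up to the factor -i for odd vectors, on the
coordinates of the vectors of parity [b]. *)
Definition folded_dft b : 'M[R]_(halfdim N b) :=
  parity_ext b *m colsub (@pos N N_gt0 b) (dft_part b).

Lemma parity_ext_dft b : parity_ext b *m dft_part b = folded_dft b *m parity_ext b.
Proof. by rewrite {1}dft_part_parity mulmxA. Qed.

Lemma parity_ext_inj b p (A B : 'M[R]_(p, halfdim N b)) :
  A *m parity_ext b = B *m parity_ext b -> A = B.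
Proof.
move/(congr1 (colsub (@pos N N_gt0 b))).
by rewrite -2!mulmx_colsub parity_ext_pos !mulmx1.
Qed.

Lemma folded_dftK b : folded_dft b *m folded_dft b = 1%:M.
Proof.
apply: parity_ext_inj; rewrite -mulmxA -parity_ext_dft mulmxA -parity_ext_dft.
rewrite mul1mx -[RHS]mulmx1 -dft_part_isometry mulmxDr !mulmxA.
by case: b; rewrite parity_ext_dft_neq mul0mx ?add0r ?addr0.
Qed.

(** The number of labels plus or minus [i + b]: usually 2, but 1 at the labels 0
and N/2. *)
Definition fold_count b (i : nat) : R := \sum_(k < N | `|label k|%N == (i + b)%N) 1.

Lemma folded_dftE b i j : folded_dft b i j =
  fold_count b i / Num.sqrt N%:R * trig b (omega * (j + b)%:R * (i + b)%:R).
Proof.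
rewrite mxE /fold_count !mulr_suml [RHS]big_mkcond; apply: eq_bigr => k _.
rewrite mxE; case: eqP => [ki|_]; last by rewrite mul0r.
rewrite !mxE label_pos mulrAC trig_parity ki mulrA mulrA parity_sign2.
by rewrite mulrAC -pmulrn.
Qed.

Lemma fold_count_gt0 b (i : 'I_(halfdim N b)) : 0 < fold_count b i.
Proof.
rewrite /fold_count (bigD1 (pos N_gt0 i)) ?label_pos //=.
by rewrite ltr_pwDl // sumr_ge0.
Qed.

(** The data that put [folded_dft] in the form of the kernels above. *)
Definition node b (j : 'I_(halfdim N b)) : R := cos (omega * (j + b)%:R).
Definition node_weight b (j : 'I_(halfdim N b)) : R :=
  if b then sin (omega * (j + b)%:R) else 1.
Definition fold_poly b (i : 'I_(halfdim N b)) : {poly R} :=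
  (fold_count b i / Num.sqrt N%:R) *: chebyshev R b i.

Lemma folded_dft_horner b i j :
  folded_dft b i j = node_weight j * (fold_poly i).[node j].
Proof.
rewrite folded_dftE horner_chebyshev /node_weight /node.
by rewrite /fold_poly hornerZ mulrCA; case: b i j.
Qed.

Let coef_gt0 b (i : 'I_(halfdim N b)) : 0 < fold_count b i / Num.sqrt N%:R.
Proof. by rewrite divr_gt0 ?fold_count_gt0 // sqrtr_gt0 ltr0n. Qed.

Lemma size_fold_poly b (i : 'I_(halfdim N b)) : size (fold_poly i) = i.+1.
Proof.
by rewrite size_scale ?gt_eqF ?coef_gt0 //; case: (size_lead_chebyshev R b i).
Qed.

Lemma lead_fold_poly b (i : 'I_(halfdim N b)) : 0 < lead_coef (fold_poly i).
Proof.
rewrite lead_coefZ mulr_gt0 ?coef_gt0 //.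
by case: (size_lead_chebyshev R b i).
Qed.

Let omega_bound (j : nat) : (j <= N./2)%N -> 0 <= omega * j%:R <= pi.
Proof.
move=> jN; have := pi_gt0 R => pi0; rewrite /omega; apply/andP; split.
  by rewrite mulr_ge0 ?divr_ge0 ?mulr_ge0 ?ler0n ?(ltW pi0).
rewrite mulrAC ler_pdivrMr ?ltr0n // -mulrA mulrCA ler_pM2l // -natrM ler_nat.
lia.
Qed.

Let omega_gt0 : 0 < omega.
Proof. by rewrite /omega divr_gt0 ?mulr_gt0 ?pi_gt0 ?ltr0n. Qed.

Lemma node_decr b (i j : 'I_(halfdim N b)) : (i < j)%N -> node j < node i.
Proof.
move=> ij; have jh := ltn_ord j; have ih := ltn_ord i.
have h k : (k < halfdim N b)%N -> (k + b <= N./2)%N.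
  by rewrite /halfdim; case: (b) => /=; lia.
rewrite /node ltr_cos ?in_itv /= ?omega_bound ?h //.
by rewrite ltr_pM2l // ltr_nat ltn_add2r.
Qed.

Lemma node_weight_gt0 b (j : 'I_(halfdim N b)) : 0 < node_weight j.
Proof.
rewrite /node_weight; case: b j => j //; apply: sin_gt0_pi.
have := pi_gt0 R => pi0; have := ltn_ord j; rewrite {2}/halfdim => jh.
rewrite mulr_gt0 ?ltr0n ?addn1 //= /omega mulrAC ltr_pdivrMr ?ltr0n //.
rewrite -mulrA mulrCA ltr_pM2l // -natrM ltr_nat; move: jh => /=; lia.
Qed.

Implicit Types (a : 'rV[R]_N) (n m : nat).

(** * The eigenvectors of bounded width *)

(** The power (-i)^n is this sign times (-i)^(odd n). *)
Definition hermite_sign n : R := (-1) ^+ odd n./2.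

Definition hermite_eigen n a : Prop :=
  a *m dft_part (odd n) = hermite_sign n *: a /\
  a *m dft_part (~~ odd n) = 0.

Lemma dft_complexify a : dft (complexify a) =
  complexify (a *m dft_part false)
  - 'i%C *: complexify (a *m dft_part true).
Proof.
apply/rowP => l; rewrite !mxE mulr_sumr rmorph_sum /=.
rewrite [X in _ - _ * X]rmorph_sum mulr_sumr -sumrB; apply: eq_bigr => k _.
rewrite !mxE /expi sinN cosN; apply/eqP; rewrite eq_complex /=.
by apply/andP; split; apply/eqP; rewrite /trig; ring.
Qed.

Lemma hermite_eigenP n a :
  dft (complexify a) = (- 'i%C) ^+ n *: complexify a <-> hermite_eigen n a.
Proof.
have lamE : (- 'i%C) ^+ n = real_complex R (hermite_sign n) * (- 'i%C) ^+ odd n.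
  rewrite -{1}(odd_double_half n) exprD -muln2 mulnC exprM.
  have -> : (- 'i%C) ^+ 2 = -1 :> R[i] by rewrite sqrrN sqr_i.
  by rewrite mulrC /hermite_sign signr_odd rmorphXn rmorphN1.
rewrite dft_complexify lamE /hermite_eigen.
split=> [/rowP eq|[eq1 eq2]].
  suff H k : (a *m dft_part (odd n)) 0 k = hermite_sign n * a 0 k /\
       (a *m dft_part (~~ odd n)) 0 k = 0.
    by split; apply/rowP => k; have [h1 h2] := H k; rewrite ?h1 ?h2 mxE.
  have := eq k; case: (odd n) => /=; rewrite ?expr1 ?expr0 !mxE;
  by case=> /eqP + /eqP; move=> /eqP h1 /eqP h2; split; lra.
case: (odd n) eq1 eq2 => /= -> ->; apply/rowP => k; rewrite !mxE.
  by rewrite expr1 rmorphM /= add0r; ring.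
by rewrite rmorph0 rmorphM /=; ring.
Qed.

(** An eigenvector has a parity because it is a multiple of its own image under
[dft_part (odd n)]. *)
Lemma hermite_eigen_folded n a : hermite_eigen n a <->
  exists2 y, a = y *m parity_ext (odd n)
    & y *m folded_dft (odd n) = hermite_sign n *: y.
Proof.
have s2 : hermite_sign n * hermite_sign n = 1 by rewrite -expr2 sqrr_sign.
split=> [[a1 _]|[y -> yG]]; last first.
  split; last by rewrite -mulmxA parity_ext_dft_neq // mulmx0.
  by rewrite -mulmxA parity_ext_dft // mulmxA yG scalemxAl.
have aE : a = hermite_sign n *: (a *m dft_part (odd n)).
  by rewrite a1 scalerA s2 scale1r.
pose y := hermite_sign n *: (a *m colsub (@pos N N_gt0 (odd n)) (dft_part (odd n))).
have yE : y *m parity_ext (odd n) = a.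
  by rewrite -scalemxAl -mulmxA -dft_part_parity.
exists y => //; apply: parity_ext_inj.
by rewrite -mulmxA -parity_ext_dft mulmxA -scalemxAl yE.
Qed.

Definition hermite_width n : nat := (N + n + 2) %/ 4.

Definition hermite_space n a : Prop :=
  hermite_eigen n a /\
  forall k : 'I_N, (hermite_width n < `|label k|)%N -> a 0 k = 0.

(** The width bound in terms of the coordinates at the labels [i + odd n]. *)
Definition hermite_support n : nat := ((hermite_width n).+1 - odd n)%N.

Lemma hermite_spaceP n a : hermite_space n a <->
  exists y, [/\ a = y *m parity_ext (odd n),
    y *m folded_dft (odd n) = hermite_sign n *: y
    & forall i : 'I_(halfdim N (odd n)), (hermite_support n <= i)%N -> y 0 i = 0].
Proof.
rewrite /hermite_space hermite_eigen_folded; split.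
  case=> -[y aE yG] a0; exists y; split=> // i hi.
  have := a0 (pos N_gt0 i); rewrite label_pos absz_nat aE.
  rewrite (@parity_extE _ _ _ _ _ i) ?label_pos // /parity_sign andbF mulr1.
  by apply; move: hi; rewrite /hermite_support; lia.
case=> y [-> yG y0]; split; first by exists y.
move=> k hk; rewrite mxE big1 // => i _; rewrite [X in _ * X]mxE.
case: eqP => [ki|_]; last by rewrite mulr0.
by rewrite y0 ?mul0r // /hermite_support; lia.
Qed.

(** The width bound of the theorem is the one for which the dimension of
[hermite_space n] is the number of indices up to n congruent to n modulo 4. For
N even this breaks at [n = N.-1], where the multiplicity of (-i)^n is one less
than that number. *)
Lemma hermite_dims n : (n < N.-1)%N ->
  (hermite_support n <= halfdim N (odd n))%N /\
  hermite_support n = (threshold (halfdim N (odd n)) (odd n./2) + (n %/ 4).+1)%N.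
Proof.
rewrite /hermite_support /hermite_width /halfdim /threshold.
have := odd_double_half n; have := odd_double_half n./2.
case: (odd n); case: (odd n./2) => /=; lia.
Qed.

Lemma ex_hermite_space n c (Q : 'M[R]_(N, c)) :
  (n < N.-1)%N -> (c <= n %/ 4)%N ->
  exists a, [/\ a != 0, hermite_space n a & a *m Q = 0].
Proof.
move=> nN cn; have [sd sE] := hermite_dims nN.
have cs : (c + threshold (halfdim N (odd n)) (odd n./2) < hermite_support n)%N.
  by rewrite sE; lia.
have [y [y0 yG yr yQ]] := ex_eigenvector (@size_fold_poly (odd n))
  (@lead_fold_poly (odd n)) (@node_decr (odd n))
  (@node_weight_gt0 (odd n)) (@folded_dft_horner (odd n))
  (folded_dftK (odd n)) (parity_ext (odd n) *m Q) sd cs.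
exists (y *m parity_ext (odd n)); split; last by rewrite -mulmxA.
  apply: contra y0 => /eqP y0; apply/eqP; apply: parity_ext_inj.
  by rewrite y0 mul0mx.
by apply/hermite_spaceP; exists y.
Qed.

Lemma free_hermite_space n p (A : 'M[R]_(p, N)) :
  (n < N.-1)%N -> row_free A -> (forall i, hermite_space n (row i A)) ->
  (p <= (n %/ 4).+1)%N.
Proof.
move=> nN Afree AV; have [sd sE] := hermite_dims nN.
have /choice[y yP] i : exists y, [/\ row i A = y *m parity_ext (odd n),
    y *m folded_dft (odd n) = hermite_sign n *: y
    & forall k : 'I_(halfdim N (odd n)), (hermite_support n <= k)%N -> y 0 k = 0].
  exact/hermite_spaceP.
pose Y := \matrix_i y i.
have AE : A = Y *m parity_ext (odd n).
  by apply/row_matrixP => i; rewrite row_mul rowK; case: (yP i).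
have Yfree : row_free Y.
  rewrite -row_leq_rank; apply: leq_trans (mxrankM_maxl Y (parity_ext (odd n))).
  by rewrite -AE row_leq_rank.
have := row_free_eigenvectors (@size_fold_poly (odd n))
  (@lead_fold_poly (odd n)) (@node_decr (odd n))
  (@node_weight_gt0 (odd n)) (@folded_dft_horner (odd n))
  (e := odd n./2) sd Yfree.
rewrite sE addKn; apply.
  apply/row_matrixP => i; rewrite row_mul [RHS]linearZ /= rowK.
  by case: (yP i).
by move=> i k hk; rewrite mxE; case: (yP i) => _ _ ->; rewrite ?sE.
Qed.

Lemma hermite_eigen_orth n m a b : n != m %[mod 4] ->
  hermite_eigen n a -> hermite_eigen m b -> dotv a b = 0.
Proof.
move=> nm [a1 a2] [b1 b2].
have sym c := dotv_sym a b (dft_part_tr c).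
have s1 k : hermite_sign k != 0 by rewrite signr_eq0.
have [onm|onm] := eqVneq (odd n) (odd m); last first.
  have := sym (odd n); have -> : b *m dft_part (odd n) = 0.
    by move: onm b2; case: (odd n); case: (odd m).
  rewrite a1 dotvZl dotvC [RHS]dotvC dotv0l => /eqP.
  by rewrite mulf_eq0 (negPf (s1 n)) => /eqP.
have := sym (odd n); rewrite a1 onm b1 dotvZl [RHS]dotvC dotvZl [dotv b a]dotvC.
have : odd n./2 != odd m./2 by apply/eqP; lia.
rewrite /hermite_sign; case: (odd n./2); case: (odd m./2) => //= _; lra.
Qed.

Lemma hermite_space_mod n m a : (m <= n)%N -> m = n %[mod 4] ->
  hermite_space m a -> hermite_space n a.
Proof.
move=> mn modmn [[a1 a2] a0].
have oE : odd m = odd n by lia.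
have hE : odd m./2 = odd n./2 by lia.
split; first by rewrite /hermite_eigen /hermite_sign -oE -hE.
by move=> k hk; apply: a0; move: hk; rewrite /hermite_width; lia.
Qed.

Lemma hermite_spaceZ n c a : hermite_space n a -> hermite_space n (c *: a).
Proof.
move=> [[a1 a2] a0]; split=> [|k /a0 ak]; last by rewrite mxE ak mulr0.
by split; rewrite -scalemxAl ?a1 ?a2 ?scaler0 // !scalerA mulrC.
Qed.

Lemma hermite_spaceB n a b :
  hermite_space n a -> hermite_space n b -> hermite_space n (a - b).
Proof.
move=> [[a1 a2] a0] [[b1 b2] b0]; split=> [|k hk].
  by split; rewrite mulmxBl ?a1 ?b1 ?a2 ?b2 ?subrr // scalerBr.
by rewrite !mxE a0 ?b0 ?subrr.
Qed.

(** * Existence and uniqueness *)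

(** The vectors are indexed by natural numbers, so that families of length [m]
can be built by induction on [m]. *)
Definition hermite_family (T : nat -> 'rV[R]_N) (m : nat) : Prop :=
  (forall n, (n < m)%N -> (n < N.-1)%N -> hermite_space n (T n)) /\
  (forall n k, (n < m)%N -> (k < m)%N -> dotv (T n) (T k) = (n == k)%:R).

Lemma extend_hermite_family T m u :
  hermite_family T m -> u != 0 -> ((m < N.-1)%N -> hermite_space m u) ->
  (forall k, (k < m)%N -> dotv u (T k) = 0) ->
  exists T', hermite_family T' m.+1.
Proof.
move=> [TV TT] u0 uV uT; have [c cc] := ex_unit u0.
exists (fun n => if n == m then c *: u else T n); split=> [n|n k].
  by case: eqP => [->|nm] nm1 nN; [apply/hermite_spaceZ/uV | apply: TV => //; lia].
move=> nm km; case: (eqVneq n m) => [->|nm'].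
  case: (eqVneq k m) => [km0|km']; first by rewrite ?km0 ?eqxx.
  by rewrite dotvZl uT ?mulr0 //; lia.
case: (eqVneq k m) => [->|km']; last by apply: TT; lia.
by rewrite dotvC dotvZl uT ?mulr0 ?(negPf nm') //; lia.
Qed.

Lemma ex_hermite_family : exists T, hermite_family T N.
Proof.
suff H m : (m <= N)%N -> exists T, hermite_family T m by exact: H.
elim: m => [_|m IHm mN]; first by exists (fun=> 0).
have [T TH] := IHm (ltnW mN); have [TV TT] := TH.
have [mN1|mN1] := ltnP m N.-1; last first.
  pose Q : 'M[R]_(N, m) := \matrix_(i, k) T k 0 i.
  have [|u [u0 _ uQ]] := @ex_sub_ker _ _ _ _ 1%:M Q; first by rewrite mxrank1.
  apply: (extend_hermite_family TH u0) => [|k km]; first by lia.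
  have /rowP/(_ (Ordinal km)) := uQ; rewrite !mxE => <-.
  by apply: eq_bigr => i _; rewrite mxE.
pose Q : 'M[R]_(N, m %/ 4) := \matrix_(i, j) T (m - 4 * j.+1)%N 0 i.
have [u [u0 uV uQ]] := ex_hermite_space Q mN1 (leqnn _).
apply: (extend_hermite_family TH u0) => // k km.
have [kmod|kmod] := eqVneq (m %% 4)%N (k %% 4)%N; last first.
  apply: (hermite_eigen_orth kmod); first by case: uV.
  by case: (TV k) => //; lia.
(* Column [j] of [Q] is [T (m - 4 j.+1)], hence the predecessor. *)
have jm : (((m - k) %/ 4).-1 < m %/ 4)%N by lia.
have /rowP/(_ (Ordinal jm)) := uQ; rewrite !mxE => <-.
apply: eq_bigr => i _; rewrite mxE; congr (_ * T _ 0 i) => /=; lia.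
Qed.

(** Let [u] be the component of [T' n] orthogonal to [T n]. If it were not
zero, [u] and the vectors [T n], [T (n - 4)], [T (n - 8)], and so on would be
too many independent vectors of [hermite_space n]. *)
Lemma hermite_family_unique T T' : hermite_family T N -> hermite_family T' N ->
  forall n, (n < N)%N -> T' n = T n \/ T' n = - T n.
Proof.
move=> [TV TT] [TV' TT']; elim/ltn_ind => n IHn nN.
pose c := dotv (T' n) (T n); pose u := T' n - c *: T n.
have uT k : (k <= n)%N -> dotv u (T k) = 0.
  rewrite leq_eqVlt => /orP[/eqP->|kn].
    by rewrite dotvBl dotvZl TT // eqxx mulr1 subrr.
  have kN := ltn_trans kn nN.
  rewrite dotvBl dotvZl TT // gtn_eqF // mulr0 subr0.
  have := TT' n k nN kN; rewrite gtn_eqF //.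
  case: (IHn k kn kN) => -> // /eqP.
  by rewrite dotvC -scaleN1r dotvZl mulN1r oppr_eq0 dotvC => /eqP.
suff u0 : u = 0.
  have T'E : T' n = c *: T n by apply/eqP; rewrite -subr_eq0 -/u u0.
  have := TT' n n nN nN; rewrite eqxx {1}T'E dotvZl dotvC -/c => /eqP.
  rewrite -expr2 sqrf_eq1 T'E => /orP[]/eqP->; first by left; rewrite scale1r.
  by right; rewrite scaleN1r.
have [nN1|nN1] := ltnP n N.-1; last first.
  rewrite (@orthonormal_expand _ _ (fun i => T i) u); last first.
    by move=> i j; rewrite TT.
  by rewrite big1 // => i _; rewrite uT ?scale0r //; have := ltn_ord i; lia.
apply/eqP; apply: contraT => u0; have [d dd] := ex_unit u0.
pose F (j : nat) := if j is j'.+1 then T (n - 4 * j')%N else d *: u.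
pose A : 'M[R]_((n %/ 4).+2, N) := \matrix_(j < (n %/ 4).+2) F j.
have FF (i j : 'I_(n %/ 4).+2) : dotv (F i) (F j) = (i == j)%:R.
  case: i j => [[|i] ip] [[|j] jp]; rewrite /F -val_eqE //=.
  - by rewrite dotvZl uT ?mulr0 ?leq_subr.
  - by rewrite dotvC dotvZl uT ?mulr0 ?leq_subr.
  - rewrite TT; [|lia|lia]; congr (nat_of_bool _)%:R.
    by rewrite eqSS; apply/eqP/eqP; lia.
have Afree : row_free A.
  apply/row_freeP; exists A^T; apply/matrixP => i j.
  rewrite [RHS]mxE -FF mxE; apply: eq_bigr => k _; by rewrite !mxE.
suff /(free_hermite_space nN1 Afree) : forall i, hermite_space n (row i A) by lia.
case=> [[|j] jp]; rewrite rowK /F /=.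
  apply/hermite_spaceZ/hermite_spaceB; first exact: TV'.
  exact/hermite_spaceZ/TV.
by apply: (@hermite_space_mod n (n - 4 * j)); [lia|lia|apply: TV; lia].
Qed.

(** A symmetric matrix that preserves a hyperplane has its normal as an
eigenvector. *)
Lemma last_eigen T (X : 'M[R]_N) : hermite_family T N -> X^T = X ->
  (forall n, (n < N.-1)%N -> exists c, T n *m X = c *: T n) ->
  exists c, T N.-1 *m X = c *: T N.-1.
Proof.
move=> [_ TT] XT Teig; have lN : (N.-1 < N)%N by lia.
exists (dotv (T N.-1 *m X) (T N.-1)).
rewrite {1}(@orthonormal_expand _ _ (fun i => T i) (T N.-1 *m X)); last first.
  by move=> i j; rewrite TT.
rewrite (bigD1 (Ordinal lN)) //= big1 ?addr0 // => i iN.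
have iN1 : (i < N.-1)%N by move: iN; rewrite -val_eqE /=; have := ltn_ord i; lia.
have [c Tc] := Teig i iN1.
by rewrite dotv_sym // Tc dotvC dotvZl TT // ltn_eqF // mulr0 scale0r.
Qed.

Lemma hermite_family_basis T : hermite_family T N ->
  minimal_hermite_basis (fun i : 'I_N => T i).
Proof.
move=> TH; have [TV TT] := TH.
have Tneq0 n : (n < N)%N -> T n != 0.
  move=> nN; apply/eqP => T0; have := TT n n nN nN.
  by rewrite T0 dotv0l eqxx => /esym/eqP; rewrite oner_eq0.
have part b : exists c, T N.-1 *m dft_part b = c *: T N.-1.
  apply: last_eigen => // [|n nN1]; first exact: dft_part_tr.
  have [|[h1 h2] _] := TV n _ nN1; first by lia.
  have [->|bn] := eqVneq b (odd n); first by exists (hermite_sign n).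
  exists 0; rewrite scale0r -h2; congr (_ *m dft_part _).
  by move: bn; case: b; case: (odd n).
have [cc ccE] := part false; have [cs csE] := part true.
split.
- exists (fun i : 'I_N => if (i < N.-1)%N then (- 'i%C) ^+ i
      else real_complex R cc - 'i%C * real_complex R cs).
  split=> [n|n ->] //; split.
    apply: contra (Tneq0 n (ltn_ord n)) => /eqP/rowP T0; apply/eqP/rowP => k.
    by have := T0 k; rewrite !mxE => -[].
  case: ifP => nN1; first by apply/hermite_eigenP; case: (TV n).
  have -> : nat_of_ord n = N.-1 by have := ltn_ord n; lia.
  rewrite dft_complexify ccE csE; apply/rowP => k; rewrite !mxE !rmorphM /=.
  by ring.
- by apply: orthonormal_basis_of => m n; rewrite TT.
- move=> n; apply/width_leP; first exact: Tneq0.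
  have [nN1|nN1] := ltnP n N.-1; first by case: (TV n (ltn_ord n) nN1).
  by move=> k; have := label_bound k; have := ltn_ord n; lia.
Qed.

Lemma basis_hermite_family (T : 'I_N -> 'rV[R]_N) : minimal_hermite_basis T ->
  hermite_family (fun n => oapp T 0 (insub n)) N.
Proof.
move=> [[lam [Teig lamE]] [TT _] Tw]; split=> [n nN nN1|n k nN kN].
  rewrite insubT /=; have [Tn0] := Teig (Ordinal nN).
  rewrite lamE // => /hermite_eigenP Te; split=> //.
  apply/width_leP; last exact: (Tw (Ordinal nN)).
  apply: contra Tn0 => /eqP->; apply/eqP/rowP => j.
  by rewrite !mxE.
by rewrite !insubT /= TT -val_eqE.
Qed.
End DFT.

Theorem theorem1p3 (R : realType) (N : nat) (hN : (2 <= N)%N) :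
  exists T : 'I_N -> 'rV[R]_N,
    minimal_hermite_basis T /\
    forall T' : 'I_N -> 'rV[R]_N, minimal_hermite_basis T' ->
      forall n : 'I_N, T' n = T n \/ T' n = - T n.
Proof.
have N_gt0 : (0 < N)%N by exact: ltnW.
have [T TH] := ex_hermite_family R N_gt0.
exists (fun i => T i); split; first exact: hermite_family_basis.
move=> T' /basis_hermite_family T'H n.
have := hermite_family_unique N_gt0 TH T'H (ltn_ord n).
by rewrite valK.
Qed.
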